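(* Let $0<\alpha<1$, let $A$ be a strictly positive continuous function, and let $U_L=(\rho_L,u_L,v_L)$, $U_R=(\rho_R,u_R,v_R)$ with $\rho_L,\rho_R>0$. Write $A_L=A(v_L)$, $A_R=A(v_R)$, $r=(A_R/A_L)^{1/\alpha}$, $\gamma=\frac{\alpha+1}2$. (a) There exists a wave combination $\mathrm{SDW}+R_3$ connecting $U_L$ to $U_R$ if and only if $r\rho_L<\rho_R$, $$u_R<u_L+\frac{2\sqrt{\alpha A_R}}{\alpha+1}\Big(\frac1{(r\rho_L)^\gamma}-\frac1{\rho_R^\gamma}\Big)-\frac{\sqrt{\alpha A_R}}{(r\rho_L)^\gamma}-\sqrt{\frac{\alpha A_L}{\rho_L^{\alpha+1}}}$$ and $$u_R>u_L-\sqrt{\frac{\alpha A_R}{\rho_R^{\alpha+1}}}-\frac1{\sqrt{\rho_L}}\sqrt{\frac{(\alpha-1)A_R}{\rho_R^\alpha}+\frac{A_L}{\rho_L^\alpha}};$$ in that case the intermediate state is unique. (b) There exists a wave combination $R_1+\mathrm{SDW}$ connecting $U_L$ to $U_R$ if and only if $\rho_R<r\rho_L$, $$u_R<u_L-\frac{\sqrt{\alpha A_L}}{(\rho_R/r)^\gamma}-\sqrt{\frac{\alpha A_R}{\rho_R^{\alpha+1}}}+\frac{2\sqrt{\alpha A_L}}{\alpha+1}\Big(\frac1{(\rho_R/r)^\gamma}-\frac1{\rho_L^\gamma}\Big)$$ and $$u_R>u_L-\sqrt{\frac{\alpha A_L}{\rho_L^{\alpha+1}}}-\frac1{\sqrt{\rho_R}}\sqrt{\frac{(\alpha-1)A_L}{\rho_L^\alpha}+\frac{A_R}{\rho_R^\alpha}};$$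 in that case the intermediate state is unique.
   Context: System: $\rho_t+(\rho u)_x=0$, $(\rho u)_t+(\rho u^2-A(v)\rho^{-\alpha})_x=0$, $(\rho v)_t+(\rho uv)_x=0$, $\rho>0$, with characteristic speeds $\lambda_1=u-\sqrt{\alpha A(v)\rho^{-\alpha-1}}$, $\lambda_2=u$, $\lambda_3=u+\sqrt{\alpha A(v)\rho^{-\alpha-1}}$. For states $U_-,U_+$ and $[\cdot]=\cdot_+-\cdot_-$, the speed of the singular shock (shadow wave, SDW) from $U_-$ to $U_+$ is $$c=s_{\mathrm{SDW}}(U_-,U_+)=\frac{[\rho u]+\sqrt{\Delta}}{[\rho]},\quad \Delta=[\rho u]^2-[\rho]\Big[\rho u^2-\frac{A(v)}{\rho^\alpha}\Big]\quad\text{if }[\rho]\ne0,\qquad c=\frac{[\rho u^2-A(v)\rho^{-\alpha}]}{2[\rho u]}\quad\text{if }[\rho]=0.$$ A combination $\mathrm{SDW}+R_3$ connecting $U_L$ to $U_R$ is an intermediate state $U_M=(\rho_M,u_M,v_R)$ with $0<\rho_M<\rho_R$, $u_M=u_R-\frac{2\sqrt{\alpha A_R}}{\alpha+1}(\rho_M^{-\frac{\alpha+1}2}-\rho_R^{-\frac{\alpha+1}2})$ (i.e. $U_M$ is joined to $U_R$ by a 3-rarefaction) and $s_{\mathrm{SDW}}(U_L,U_M)=\lambda_3(U_M)<\lambda_1(U_L)$. A combination $R_1+\mathrm{SDW}$ connecting $U_L$ to $U_R$ is an intermediate state $U_M=(\rho_M,u_M,v_L)$ with $0<\rho_M<\rho_L$,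 $u_M=u_L+\frac{2\sqrt{\alpha A_L}}{\alpha+1}(\rho_M^{-\frac{\alpha+1}2}-\rho_L^{-\frac{\alpha+1}2})$ (i.e. $U_L$ is joined to $U_M$ by a 1-rarefaction) and $s_{\mathrm{SDW}}(U_M,U_R)=\lambda_1(U_M)>\lambda_3(U_R)$. *)

(* Defs.v *)
From Stdlib Require Import Reals.
Open Scope R_scope.

Record state : Type := mkState { rho : R; u : R; v : R }.

(** [Rpower x y] is the real power [x^y] only for [0 < x]; below it is only
    ever applied to densities that are assumed positive. *)

Definition lambda1 (alpha : R) (A : R -> R) (U : state) : R :=
  u U - sqrt (alpha * A (v U) * Rpower (rho U) (- alpha - 1)).

Definition lambda3 (alpha : R) (A : R -> R) (U : state) : R :=
  u U + sqrt (alpha * A (v U) * Rpower (rho U) (- alpha - 1)).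

Definition jump (f : state -> R) (Um Up : state) : R := f Up - f Um.

Definition momentum (U : state) : R := rho U * u U.

Definition momentum_flux (alpha : R) (A : R -> R) (U : state) : R :=
  rho U * u U ^ 2 - A (v U) / Rpower (rho U) alpha.

Definition SDW_discr (alpha : R) (A : R -> R) (Um Up : state) : R :=
  jump momentum Um Up ^ 2
  - jump rho Um Up * jump (momentum_flux alpha A) Um Up.

(** Real division and [sqrt] are total, so this function also takes (arbitrary)
    values where the formula for the speed makes no sense; [SDW_speed_defined]
    singles out the pairs of states for which it does. *)
Definition SDW_speed (alpha : R) (A : R -> R) (Um Up : state) : R :=
  if Req_dec_T (jump rho Um Up) 0
  then jump (momentum_flux alpha A) Um Up / (2 * jump momentum Um Up)
  else (jump momentum Um Up + sqrt (SDW_discr alpha A Um Up)) / jump rho Um Up.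

Definition SDW_speed_defined (alpha : R) (A : R -> R) (Um Up : state) : Prop :=
  (jump rho Um Up <> 0 -> 0 <= SDW_discr alpha A Um Up) /\
  (jump rho Um Up = 0 -> jump momentum Um Up <> 0).

(** [UM] is the intermediate state of a combination SDW + R_3 from [UL] to
    [UR]. *)
Definition SDW_R3 (alpha : R) (A : R -> R) (UL UR UM : state) : Prop :=
  v UM = v UR /\
  0 < rho UM < rho UR /\
  u UM = u UR - 2 * sqrt (alpha * A (v UR)) / (alpha + 1)
                * (Rpower (rho UM) (- ((alpha + 1) / 2))
                   - Rpower (rho UR) (- ((alpha + 1) / 2))) /\
  SDW_speed_defined alpha A UL UM /\
  SDW_speed alpha A UL UM = lambda3 alpha A UM /\
  lambda3 alpha A UM < lambda1 alpha A UL.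

(** [UM] is the intermediate state of a combination R_1 + SDW from [UL] to
    [UR]. *)
Definition R1_SDW (alpha : R) (A : R -> R) (UL UR UM : state) : Prop :=
  v UM = v UL /\
  0 < rho UM < rho UL /\
  u UM = u UL + 2 * sqrt (alpha * A (v UL)) / (alpha + 1)
                * (Rpower (rho UM) (- ((alpha + 1) / 2))
                   - Rpower (rho UL) (- ((alpha + 1) / 2))) /\
  SDW_speed_defined alpha A UM UR /\
  SDW_speed alpha A UM UR = lambda1 alpha A UM /\
  lambda1 alpha A UM > lambda3 alpha A UR.

(* Main.v *)
Require Import Defs.
From Stdlib Require Import Reals Ranalysis5 Lra.
Open Scope R_scope.

(** Write [K = sqrt (alpha * AR)], [gamma = (alpha + 1) / 2], and let
    [x = rho UM] be the density of the intermediate state of SDW + R_3.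

    Multiplying out, the formula for the shadow-wave speed says that [c] is a
    root of
    [rho_+ (c - u_+)^2 - rho_- (c - u_-)^2 = A_+ rho_+^(-alpha) - A_- rho_-^(-alpha)],
    and the sign of the square root picks the right one of the two roots as soon
    as [u_+ < c < u_-] ([SDW_speed_iff]).  This ordering holds for
    SDW + R_3, since [c = lambda3 UM > u UM] and [c < lambda1 UL < u UL].
    As [rho UM * (c - u UM)^2 = alpha AR x^(-alpha)], the relation
    determines [c] in terms of [x]:
    [c = uL - sqrt ((alpha - 1) AR x^(-alpha) + AL rhoL^(-alpha)) / sqrt rhoL],
    and then [c < lambda1 UL] means exactly
    [AR x^(-alpha) < AL rhoL^(-alpha)], that is, [r rhoL < x].
    On the other side, along the rarefaction curve
    [lambda3 UM = const - K (1 - alpha) / (1 + alpha) x^(-gamma)].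
    So an intermediate state is the same as a zero in the open interval
    [(r rhoL, rhoR)] of [lambda3 UM] minus the shadow-wave speed ([SDW_R3_iff]).
    Because [alpha < 1], this difference is strictly increasing
    ([speed_gap_incr]), hence the zero is unique, and by the intermediate value
    theorem it exists iff the difference is negative at [r rhoL] and positive at
    [rhoR]; these are the two stated inequalities on [uR].

    The claim for R_1 + SDW follows by reflecting the space variable, which
    negates the velocities, exchanges the left and right states and turns
    R_1 + SDW into SDW + R_3 ([R1_SDW_mirror]). *)

(** * Powers *)

Lemma Rpower_pos (x y : R) : 0 < Rpower x y.
Proof. apply exp_pos. Qed.

Lemma Rdiv_Rpower_lt_iff (k a x y : R) :
  0 < k -> 0 < a -> 0 < x -> 0 < y ->
  (k / Rpower y a < k / Rpower x a <-> x < y).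
Proof.
  intros Hk Ha Hx Hy.
  assert (Hmono : forall s t, 0 < s -> s < t ->
            k / Rpower t a < k / Rpower s a).
  { intros s t Hs Hst.
    apply Rmult_lt_compat_l; [exact Hk|].
    apply Rinv_lt_contravar.
    - apply Rmult_lt_0_compat; apply Rpower_pos.
    - apply Rlt_Rpower_l; lra. }
  split; [|now apply Hmono].
  intros H. destruct (Rtotal_order x y) as [Hl|[He|Hg]]; [exact Hl| |].
  - subst y. lra.
  - specialize (Hmono y x Hy Hg). lra.
Qed.

Lemma Rpower_opp_inv (x a : R) : Rpower x (- a) = 1 / Rpower x a.
Proof. rewrite Rpower_Ropp. unfold Rdiv. ring. Qed.

Lemma Rpower_inv_base (x y : R) : 0 < x -> Rpower (/ x) y = / Rpower x y.
Proof.
  intros Hx. unfold Rpower. rewrite ln_Rinv by exact Hx.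
  rewrite <- exp_Ropp. f_equal. ring.
Qed.

Lemma sqrt_Rpower (x a : R) : sqrt (Rpower x a) = Rpower x (a / 2).
Proof.
  rewrite <- (sqrt_Rsqr (Rpower x (a / 2))); [|left; apply Rpower_pos].
  f_equal. unfold Rsqr. rewrite <- Rpower_plus. f_equal. field.
Qed.

Lemma sqrt_mult_Rpower (k alpha x : R) :
  0 <= k ->
  sqrt (k * Rpower x (- alpha - 1)) = sqrt k / Rpower x ((alpha + 1) / 2).
Proof.
  intros Hk. rewrite sqrt_mult; [|exact Hk|left; apply Rpower_pos].
  rewrite sqrt_Rpower.
  replace ((- alpha - 1) / 2) with (- ((alpha + 1) / 2)) by field.
  rewrite Rpower_Ropp. reflexivity.
Qed.

Lemma sqrt_div_Rpower (k alpha x : R) :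
  0 <= k ->
  sqrt (k / Rpower x (alpha + 1)) = sqrt k / Rpower x ((alpha + 1) / 2).
Proof.
  intros Hk. rewrite <- sqrt_mult_Rpower by exact Hk.
  unfold Rdiv. rewrite <- Rpower_Ropp. do 3 f_equal. ring.
Qed.

(** This is [rho * (lambda3 - u)^2 = alpha * A * rho^(-alpha)]. *)
Lemma sound_speed_sqr (k alpha x : R) :
  0 <= k -> 0 < x ->
  x * (sqrt k / Rpower x ((alpha + 1) / 2)) ^ 2 = k / Rpower x alpha.
Proof.
  intros Hk Hx.
  assert (E : Rpower x ((alpha + 1) / 2) ^ 2 = x * Rpower x alpha).
  { simpl. rewrite Rmult_1_r, <- Rpower_plus.
    replace ((alpha + 1) / 2 + (alpha + 1) / 2) with (1 + alpha) by field.
    rewrite Rpower_plus, Rpower_1 by exact Hx. reflexivity. }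
  assert (Hne : Rpower x ((alpha + 1) / 2) <> 0) by apply Rgt_not_eq, Rpower_pos.
  assert (Hne' : Rpower x alpha <> 0) by apply Rgt_not_eq, Rpower_pos.
  transitivity (x * sqrt k ^ 2 / Rpower x ((alpha + 1) / 2) ^ 2); [now field|].
  rewrite E, pow2_sqrt by exact Hk. field. lra.
Qed.

Lemma continuity_pt_div_Rpower (k a x : R) :
  0 < x -> continuity_pt (fun y => k / Rpower y a) x.
Proof.
  intros Hx. apply derivable_continuous_pt.
  apply (derivable_pt_div (fun _ => k) (fun y => Rpower y a)).
  - apply derivable_pt_const.
  - exists (a * Rpower x (a - 1)). now apply derivable_pt_lim_power.
  - apply Rgt_not_eq, Rpower_pos.
Qed.

(** * The speed of a shadow wave *)

(** [SDW_discr] equals [D^2 - [rho] Q], where [Q] is the left minus the right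
    side of the quadratic equation for [c] and [D = [rho] c - [rho u]] is
    positive by the ordering of the velocities; so, for [[rho] <> 0], [Q = 0] iff
    [D = sqrt SDW_discr].  When [[rho] = 0] the equation is linear in [c], and
    the ordering makes its leading coefficient nonzero. *)
Lemma SDW_speed_iff (alpha : R) (A : R -> R) (Um Up : state) (c : R) :
  0 < rho Um -> 0 < rho Up -> u Up < c < u Um ->
  (SDW_speed_defined alpha A Um Up /\ SDW_speed alpha A Um Up = c <->
   rho Up * (c - u Up) ^ 2 - rho Um * (u Um - c) ^ 2
   = A (v Up) / Rpower (rho Up) alpha - A (v Um) / Rpower (rho Um) alpha).
Proof.
  intros Hm Hp Hc.
  unfold SDW_speed_defined, SDW_speed, SDW_discr, jump, momentum_flux, momentum.
  set (p := A (v Up) / Rpower (rho Up) alpha).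
  set (m := A (v Um) / Rpower (rho Um) alpha).
  destruct Um as [rm um vm], Up as [rp up vp]; cbn [rho u v] in *.
  set (Delta := _ - (rp - rm) * _).
  set (D := rp * (c - up) + rm * (um - c)).
  assert (HD : 0 < D).
  { apply Rplus_lt_0_compat; apply Rmult_lt_0_compat; lra. }
  assert (EDelta : Delta = D ^ 2
     - (rp - rm) * (rp * (c - up) ^ 2 - rm * (um - c) ^ 2 - (p - m))).
  { unfold Delta, D. ring. }
  assert (ED : (rp - rm) * c = rp * up - rm * um + D) by (unfold D; ring).
  destruct (Req_dec_T (rp - rm) 0) as [Hr|Hr].
  - assert (Hmom : rp * up - rm * um <> 0).
    { replace rp with rm by lra.
      replace (rm * up - rm * um) with (- (rm * (um - up))) by ring.
      apply Ropp_neq_0_compat, Rgt_not_eq, Rmult_lt_0_compat; lra. }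
    split.
    + intros [_ E].
      apply (Rmult_eq_compat_r (2 * (rp * up - rm * um))) in E.
      unfold Rdiv in E. rewrite Rmult_assoc, Rinv_l, Rmult_1_r in E by lra.
      replace rp with rm in * by lra. lra.
    + intros E. split; [split; [now intros []|now intros _]|].
      apply (Rmult_eq_reg_r (2 * (rp * up - rm * um))); [|lra].
      unfold Rdiv. rewrite Rmult_assoc, Rinv_l, Rmult_1_r by lra.
      replace rp with rm in * by lra. lra.
  - split.
    + intros [[Hd _] E]. specialize (Hd Hr).
      assert (ES : sqrt Delta = D).
      { apply (Rmult_eq_compat_r (rp - rm)) in E.
        unfold Rdiv in E. rewrite Rmult_assoc, Rinv_l, Rmult_1_r in E by lra.
        lra. }
      assert (E2 : Delta = D ^ 2).
      { rewrite <- ES. symmetry. now apply pow2_sqrt. }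
      assert (E3 : (rp - rm) *
                 (rp * (c - up) ^ 2 - rm * (um - c) ^ 2 - (p - m)) = 0) by lra.
      apply Rmult_integral in E3. destruct E3; [contradiction|lra].
    + intros E.
      assert (E2 : Delta = D ^ 2).
      { rewrite EDelta, E. ring. }
      split; [split; [|now intros]|].
      * intros _. rewrite E2. apply pow2_ge_0.
      * rewrite E2, sqrt_pow2 by lra. rewrite <- ED. now field.
Qed.

(** * Reduction of SDW + R_3 to a scalar equation *)

(** The speed [lambda3] at density [x] on the backward 3-rarefaction curve
    through the right state. *)
Definition fan_speed (alpha AR rhoR uR x : R) : R :=
  uR - 2 * sqrt (alpha * AR) / (alpha + 1)
       * (1 / Rpower x ((alpha + 1) / 2) - 1 / Rpower rhoR ((alpha + 1) / 2))
  + sqrt (alpha * AR) / Rpower x ((alpha + 1) / 2).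

Definition shadow_radicand (alpha AL AR rhoL x : R) : R :=
  (alpha - 1) * AR / Rpower x alpha + AL / Rpower rhoL alpha.

(** The root [c < uL] of the shadow-wave equation when the state on the right
    has density [x] and [lambda3 = c], i.e. when the wave is attached to the
    trailing end of a 3-rarefaction. *)
Definition shadow_speed (alpha AL AR rhoL uL x : R) : R :=
  uL - 1 / sqrt rhoL * sqrt (shadow_radicand alpha AL AR rhoL x).

Definition speed_gap (alpha AL AR rhoL uL rhoR uR x : R) : R :=
  fan_speed alpha AR rhoR uR x - shadow_speed alpha AL AR rhoL uL x.

Lemma threshold_eq (alpha AL AR rhoL : R) :
  0 < alpha -> 0 < AL -> 0 < AR -> 0 < rhoL ->
  AR / Rpower (Rpower (AR / AL) (1 / alpha) * rhoL) alpha
  = AL / Rpower rhoL alpha.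
Proof.
  intros Ha HL HR Hr.
  rewrite <- Rpower_mult_distr by (assumption || apply Rpower_pos).
  rewrite Rpower_mult.
  replace (1 / alpha * alpha) with 1 by (field; lra).
  rewrite Rpower_1 by now apply Rdiv_lt_0_compat.
  field. repeat split; try lra. apply Rgt_not_eq, Rpower_pos.
Qed.

Lemma threshold_lt_iff (alpha AL AR rhoL x : R) :
  0 < alpha -> 0 < AL -> 0 < AR -> 0 < rhoL -> 0 < x ->
  (AR / Rpower x alpha < AL / Rpower rhoL alpha <->
   Rpower (AR / AL) (1 / alpha) * rhoL < x).
Proof.
  intros Ha HL HR Hr Hx.
  rewrite <- (threshold_eq alpha AL AR rhoL) by assumption.
  apply Rdiv_Rpower_lt_iff; try assumption.
  apply Rmult_lt_0_compat; [apply Rpower_pos|assumption].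
Qed.

Lemma nonneg_root_eq (a d z : R) :
  0 < a -> 0 <= d -> a * d ^ 2 = z -> d = 1 / sqrt a * sqrt z.
Proof.
  intros Ha Hd <-.
  rewrite sqrt_mult by (lra || apply pow2_ge_0).
  rewrite sqrt_pow2 by exact Hd.
  field. apply Rgt_not_eq, sqrt_lt_R0, Ha.
Qed.

Lemma SDW_R3_iff (alpha : R) (A : R -> R) (rhoL uL vL rhoR uR vR : R)
  (UM : state) :
  0 < alpha < 1 -> (forall x, 0 < A x) -> 0 < rhoL -> 0 < rhoR ->
  (SDW_R3 alpha A (mkState rhoL uL vL) (mkState rhoR uR vR) UM <->
   v UM = vR /\
   Rpower (A vR / A vL) (1 / alpha) * rhoL < rho UM < rhoR /\
   u UM = uR - 2 * sqrt (alpha * A vR) / (alpha + 1)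
               * (Rpower (rho UM) (- ((alpha + 1) / 2))
                  - Rpower rhoR (- ((alpha + 1) / 2))) /\
   speed_gap alpha (A vL) (A vR) rhoL uL rhoR uR (rho UM) = 0).
Proof.
  intros Ha HA HL HR.
  destruct UM as [x w vM]. unfold SDW_R3; cbn [rho u v].
  pose proof (HA vL) as HAL. pose proof (HA vR) as HAR.
  assert (HaL : 0 < alpha * A vL) by (apply Rmult_lt_0_compat; lra).
  assert (HaR : 0 < alpha * A vR) by (apply Rmult_lt_0_compat; lra).
  set (sL := sqrt (alpha * A vL) / Rpower rhoL ((alpha + 1) / 2)).
  set (s := sqrt (alpha * A vR) / Rpower x ((alpha + 1) / 2)).
  assert (HsL : 0 < sL).
  { apply Rdiv_lt_0_compat; [now apply sqrt_lt_R0|apply Rpower_pos]. }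
  assert (Hs : 0 < s).
  { apply Rdiv_lt_0_compat; [now apply sqrt_lt_R0|apply Rpower_pos]. }
  set (q := A vR / Rpower x alpha).
  set (p := A vL / Rpower rhoL alpha).
  assert (Hp : 0 < p) by (apply Rdiv_lt_0_compat; [assumption|apply Rpower_pos]).
  assert (EsL : rhoL * sL ^ 2 = alpha * p).
  { unfold sL, p. rewrite sound_speed_sqr by lra. unfold Rdiv; ring. }
  assert (Ez : shadow_radicand alpha (A vL) (A vR) rhoL x = p - (1 - alpha) * q).
  { unfold shadow_radicand, p, q, Rdiv. ring. }
  (* The two sides of the equivalence share [v UM = vR] and the rarefaction
     curve; these make [fan_speed] the speed [lambda3 UM]. *)
  assert (Hfan : w = uR - 2 * sqrt (alpha * A vR) / (alpha + 1)
               * (Rpower x (- ((alpha + 1) / 2))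
                  - Rpower rhoR (- ((alpha + 1) / 2))) ->
            fan_speed alpha (A vR) rhoR uR x = w + s).
  { intros ->. unfold fan_speed. rewrite !Rpower_opp_inv. reflexivity. }
  assert (H3 : lambda3 alpha A (mkState x w vR) = w + s).
  { unfold lambda3; cbn [rho u v]. rewrite sqrt_mult_Rpower by lra. reflexivity. }
  assert (H1 : lambda1 alpha A (mkState rhoL uL vL) = uL - sL).
  { unfold lambda1; cbn [rho u v]. rewrite sqrt_mult_Rpower by lra. reflexivity. }
  unfold speed_gap, shadow_speed. rewrite Ez.
  split.
  - intros (-> & Hx & Hw & Hdef & Hc & Hlt).
    specialize (Hfan Hw). rewrite H3 in Hc, Hlt. rewrite H1 in Hlt.
    assert (Es : x * s ^ 2 = alpha * q).
    { unfold s, q. rewrite sound_speed_sqr by lra. unfold Rdiv; ring. }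
    destruct (SDW_speed_iff alpha A (mkState rhoL uL vL) (mkState x w vR) (w + s))
      as [Hq _]; cbn [rho u v]; [lra..|].
    specialize (Hq (conj Hdef Hc)). cbn [rho u v] in Hq. fold q p in Hq.
    replace (w + s - w) with s in Hq by ring.
    assert (Hsq : sL ^ 2 < (uL - (w + s)) ^ 2)
      by (simpl; rewrite !Rmult_1_r; apply Rmult_le_0_lt_compat; lra).
    assert (Hsq' : rhoL * sL ^ 2 < rhoL * (uL - (w + s)) ^ 2)
      by now apply Rmult_lt_compat_l.
    assert (Hpq : q < p).
    { apply (Rmult_lt_reg_l (1 - alpha)); lra. }
    split; [reflexivity|]. split; [split; [|lra]|split; [exact Hw|]].
    + apply threshold_lt_iff; [lra..|exact Hpq].
    + rewrite <- (nonneg_root_eq rhoL (uL - (w + s)) (p - (1 - alpha) * q)); lra.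
  - intros (-> & [Hx1 Hx2] & Hw & Hgap).
    assert (Hx0 : 0 < x).
    { eapply Rlt_trans; [|exact Hx1].
      apply Rmult_lt_0_compat; [apply Rpower_pos|exact HL]. }
    apply threshold_lt_iff in Hx1; [|lra..]. fold q p in Hx1.
    specialize (Hfan Hw). rewrite H3, H1.
    assert (Es : x * s ^ 2 = alpha * q).
    { unfold s, q. rewrite sound_speed_sqr by lra. unfold Rdiv; ring. }
    assert (Hpq : (1 - alpha) * q < (1 - alpha) * p)
      by (apply Rmult_lt_compat_l; lra).
    assert (Hap : 0 < alpha * p) by (apply Rmult_lt_0_compat; lra).
    set (d := 1 / sqrt rhoL * sqrt (p - (1 - alpha) * q)) in Hgap.
    assert (Hsr : 0 < sqrt rhoL) by now apply sqrt_lt_R0.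
    assert (Hd : 0 < d).
    { apply Rmult_lt_0_compat; [apply Rdiv_lt_0_compat; lra|].
      apply sqrt_lt_R0. lra. }
    assert (Ed : rhoL * d ^ 2 = p - (1 - alpha) * q).
    { unfold d. rewrite Rpow_mult_distr, pow2_sqrt by lra.
      rewrite <- (pow2_sqrt rhoL) at 1 by lra. field. lra. }
    assert (HdsL : sL < d).
    { apply Rsqr_incrst_0; [|lra..].
      rewrite !Rsqr_pow2. apply (Rmult_lt_reg_l rhoL); lra. }
    assert (Hc : uL - (w + s) = d) by lra.
    assert (Hspeed : SDW_speed_defined alpha A (mkState rhoL uL vL) (mkState x w vR)
      /\ SDW_speed alpha A (mkState rhoL uL vL) (mkState x w vR) = w + s).
    { apply SDW_speed_iff; cbn [rho u v]; [lra..|]. fold q p.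
      replace (w + s - w) with s by ring. rewrite Hc. lra. }
    destruct Hspeed as [Hdef Hspeed].
    repeat split; try assumption; try apply Hdef; lra.
Qed.

(** * Monotonicity and existence *)

(** [fan_speed] is a constant minus a multiple
    [(1 - alpha) / (alpha + 1) * sqrt (alpha * AR)] of [x^(-gamma)], and
    [shadow_radicand] a constant minus [(1 - alpha) * AR * x^(-alpha)]; both
    coefficients are positive because [alpha < 1]. *)
Lemma speed_gap_incr (alpha AL AR rhoL uL rhoR uR x y : R) :
  0 < alpha < 1 -> 0 < AR -> 0 < rhoL ->
  0 < x -> x < y ->
  speed_gap alpha AL AR rhoL uL rhoR uR x
  < speed_gap alpha AL AR rhoL uL rhoR uR y.
Proof.
  intros Ha HAR HL Hx Hxy.
  assert (HK : 0 < sqrt (alpha * AR)).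
  { apply sqrt_lt_R0, Rmult_lt_0_compat; lra. }
  assert (Hfan : fan_speed alpha AR rhoR uR x < fan_speed alpha AR rhoR uR y).
  { assert (E : forall t, fan_speed alpha AR rhoR uR t
      = uR + 2 * sqrt (alpha * AR) / (alpha + 1) / Rpower rhoR ((alpha + 1) / 2)
        - (1 - alpha) / (alpha + 1) * sqrt (alpha * AR)
          / Rpower t ((alpha + 1) / 2)).
    { intros t. unfold fan_speed. field.
      repeat split; try lra; apply Rgt_not_eq, Rpower_pos. }
    rewrite !E.
    apply Rplus_lt_compat_l, Ropp_lt_contravar.
    apply Rdiv_Rpower_lt_iff; try lra.
    apply Rmult_lt_0_compat; [apply Rdiv_lt_0_compat|]; lra. }
  assert (Hrad : shadow_radicand alpha AL AR rhoL x
                 < shadow_radicand alpha AL AR rhoL y).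
  { unfold shadow_radicand.
    assert (H : (1 - alpha) * AR / Rpower y alpha
                < (1 - alpha) * AR / Rpower x alpha).
    { apply Rdiv_Rpower_lt_iff; try lra. apply Rmult_lt_0_compat; lra. }
    unfold Rdiv in *. lra. }
  assert (Hsqrt : 1 / sqrt rhoL * sqrt (shadow_radicand alpha AL AR rhoL x)
                  <= 1 / sqrt rhoL * sqrt (shadow_radicand alpha AL AR rhoL y)).
  { apply Rmult_le_compat_l.
    - left. apply Rdiv_lt_0_compat; [lra|now apply sqrt_lt_R0].
    - apply sqrt_le_1_alt. lra. }
  unfold speed_gap, shadow_speed. lra.
Qed.

Lemma speed_gap_continuity_pt (alpha AL AR rhoL uL rhoR uR x : R) :
  0 < x -> 0 <= shadow_radicand alpha AL AR rhoL x ->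
  continuity_pt (speed_gap alpha AL AR rhoL uL rhoR uR) x.
Proof.
  intros Hx Hrad.
  assert (Hcst : forall k, continuity_pt (fun _ => k) x).
  { intros k. apply continuity_pt_const. intros ? ?. reflexivity. }
  unfold speed_gap.
  apply (continuity_pt_minus (fan_speed alpha AR rhoR uR)
           (shadow_speed alpha AL AR rhoL uL)).
  - unfold fan_speed.
    apply (continuity_pt_plus
      (fun t => uR - 2 * sqrt (alpha * AR) / (alpha + 1)
         * (1 / Rpower t ((alpha + 1) / 2) - 1 / Rpower rhoR ((alpha + 1) / 2)))
      (fun t => sqrt (alpha * AR) / Rpower t ((alpha + 1) / 2)));
      [|now apply continuity_pt_div_Rpower].
    apply (continuity_pt_minus (fun _ => uR)); [apply Hcst|].
    apply (continuity_pt_mult (fun _ => 2 * sqrt (alpha * AR) / (alpha + 1)));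
      [apply Hcst|].
    apply (continuity_pt_minus (fun t => 1 / Rpower t ((alpha + 1) / 2))
             (fun _ => 1 / Rpower rhoR ((alpha + 1) / 2))); [|apply Hcst].
    now apply continuity_pt_div_Rpower.
  - unfold shadow_speed.
    apply (continuity_pt_minus (fun _ => uL)); [apply Hcst|].
    apply (continuity_pt_mult (fun _ => 1 / sqrt rhoL)); [apply Hcst|].
    apply (continuity_pt_comp (shadow_radicand alpha AL AR rhoL) sqrt);
      [|now apply continuity_pt_sqrt].
    apply (continuity_pt_plus (fun t => (alpha - 1) * AR / Rpower t alpha)
             (fun _ => AL / Rpower rhoL alpha)); [|apply Hcst].
    now apply continuity_pt_div_Rpower.
Qed.

Lemma speed_gap_zero_iff (alpha AL AR rhoL uL rhoR uR : R) :
  0 < alpha < 1 -> 0 < AL -> 0 < AR -> 0 < rhoL ->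
  let a := Rpower (AR / AL) (1 / alpha) * rhoL in
  ((exists x, a < x < rhoR /\ speed_gap alpha AL AR rhoL uL rhoR uR x = 0) <->
   a < rhoR /\
   speed_gap alpha AL AR rhoL uL rhoR uR a < 0 /\
   0 < speed_gap alpha AL AR rhoL uL rhoR uR rhoR).
Proof.
  intros Ha HAL HAR HL a.
  assert (Ha0 : 0 < a) by (apply Rmult_lt_0_compat; [apply Rpower_pos|exact HL]).
  split.
  - intros (x & [H1 H2] & E). rewrite <- E.
    split; [lra|split; apply speed_gap_incr; lra].
  - intros (Hlt & Hneg & Hpos).
    destruct (IVT_interv (speed_gap alpha AL AR rhoL uL rhoR uR) a rhoR)
      as (x & [H1 H2] & E); try assumption.
    + intros x [Hx _]. apply speed_gap_continuity_pt; [lra|].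
      (* For [x >= a] the radicand is at least
         [alpha * AL / Rpower rhoL alpha]. *)
      assert (Hq : AR / Rpower x alpha <= AL / Rpower rhoL alpha).
      { destruct Hx as [Hx|<-].
        - left. apply threshold_lt_iff; try lra. exact Hx.
        - right. apply threshold_eq; lra. }
      assert (Hp : 0 < AL / Rpower rhoL alpha).
      { apply Rdiv_lt_0_compat; [exact HAL|apply Rpower_pos]. }
      unfold shadow_radicand.
      replace ((alpha - 1) * AR / Rpower x alpha)
        with (- ((1 - alpha) * (AR / Rpower x alpha))) by (unfold Rdiv; ring).
      assert (H : (1 - alpha) * (AR / Rpower x alpha)
                  <= (1 - alpha) * (AL / Rpower rhoL alpha))
        by (apply Rmult_le_compat_l; lra).
      assert (0 < alpha * (AL / Rpower rhoL alpha))
        by (apply Rmult_lt_0_compat; lra).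
      lra.
    + exists x. split; [|exact E]. split.
      * destruct H1 as [H1|<-]; [exact H1|lra].
      * destruct H2 as [H2|H2]; [exact H2|]. rewrite H2 in E. lra.
Qed.

(** At [r * rhoL] the radicand in [shadow_speed] collapses to
    [alpha * AL * rhoL^(-alpha)], so that [shadow_speed] equals [lambda1] of the
    left state. *)
Lemma speed_gap_threshold (alpha AL AR rhoL uL rhoR uR : R) :
  0 < alpha < 1 -> 0 < AL -> 0 < AR -> 0 < rhoL ->
  let a := Rpower (AR / AL) (1 / alpha) * rhoL in
  speed_gap alpha AL AR rhoL uL rhoR uR a
  = uR - (uL + 2 * sqrt (alpha * AR) / (alpha + 1)
               * (1 / Rpower a ((alpha + 1) / 2)
                  - 1 / Rpower rhoR ((alpha + 1) / 2))
          - sqrt (alpha * AR) / Rpower a ((alpha + 1) / 2)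
          - sqrt (alpha * AL / Rpower rhoL (alpha + 1))).
Proof.
  intros Ha HAL HAR HL a.
  assert (HaL : 0 < alpha * AL) by (apply Rmult_lt_0_compat; lra).
  unfold speed_gap, shadow_speed, fan_speed.
  rewrite <- (nonneg_root_eq rhoL (sqrt (alpha * AL / Rpower rhoL (alpha + 1)))).
  - ring.
  - exact HL.
  - apply sqrt_pos.
  - rewrite sqrt_div_Rpower, sound_speed_sqr by lra.
    unfold shadow_radicand.
    replace ((alpha - 1) * AR / Rpower a alpha)
      with ((alpha - 1) * (AR / Rpower a alpha)) by (unfold Rdiv; ring).
    unfold a. rewrite threshold_eq by lra. unfold Rdiv; ring.
Qed.

Lemma speed_gap_right (alpha AL AR rhoL uL rhoR uR : R) :
  0 < alpha -> 0 < AR ->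
  speed_gap alpha AL AR rhoL uL rhoR uR rhoR
  = uR - (uL - sqrt (alpha * AR / Rpower rhoR (alpha + 1))
          - 1 / sqrt rhoL
            * sqrt ((alpha - 1) * AR / Rpower rhoR alpha
                    + AL / Rpower rhoL alpha)).
Proof.
  intros Ha HAR.
  assert (HaR : 0 < alpha * AR) by (apply Rmult_lt_0_compat; lra).
  rewrite sqrt_div_Rpower by lra.
  unfold speed_gap, shadow_speed, fan_speed, shadow_radicand. ring.
Qed.

Lemma SDW_R3_exists_iff (alpha : R) (A : R -> R) (rhoL uL vL rhoR uR vR : R) :
  0 < alpha < 1 -> (forall x, 0 < A x) -> 0 < rhoL -> 0 < rhoR ->
  let a := Rpower (A vR / A vL) (1 / alpha) * rhoL in
  ((exists UM, SDW_R3 alpha A (mkState rhoL uL vL) (mkState rhoR uR vR) UM) <->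
   a < rhoR /\
   uR < uL + 2 * sqrt (alpha * A vR) / (alpha + 1)
             * (1 / Rpower a ((alpha + 1) / 2)
                - 1 / Rpower rhoR ((alpha + 1) / 2))
        - sqrt (alpha * A vR) / Rpower a ((alpha + 1) / 2)
        - sqrt (alpha * A vL / Rpower rhoL (alpha + 1)) /\
   uR > uL - sqrt (alpha * A vR / Rpower rhoR (alpha + 1))
        - 1 / sqrt rhoL
          * sqrt ((alpha - 1) * A vR / Rpower rhoR alpha
                  + A vL / Rpower rhoL alpha)).
Proof.
  intros Ha HA HL HR a.
  pose proof (HA vL) as HAL. pose proof (HA vR) as HAR.
  pose proof (speed_gap_zero_iff alpha (A vL) (A vR) rhoL uL rhoR uR
                Ha HAL HAR HL) as Hzero.
  cbv zeta in Hzero. rewrite speed_gap_threshold, speed_gap_right in Hzero by lra.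
  fold a in Hzero.
  transitivity (exists x, a < x < rhoR /\
                  speed_gap alpha (A vL) (A vR) rhoL uL rhoR uR x = 0).
  - split.
    + intros [UM H]. apply SDW_R3_iff in H; [|assumption..].
      exists (rho UM). tauto.
    + intros (x & Hx & E).
      exists (mkState x (uR - 2 * sqrt (alpha * A vR) / (alpha + 1)
               * (Rpower x (- ((alpha + 1) / 2))
                  - Rpower rhoR (- ((alpha + 1) / 2)))) vR).
      apply SDW_R3_iff; [assumption..|]. cbn [rho u v]. tauto.
  - rewrite Hzero. split; intros (H1 & H2 & H3); repeat split; lra.
Qed.

Lemma SDW_R3_unique (alpha : R) (A : R -> R) (rhoL uL vL rhoR uR vR : R)
  (UM UM' : state) :
  0 < alpha < 1 -> (forall x, 0 < A x) -> 0 < rhoL -> 0 < rhoR ->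
  SDW_R3 alpha A (mkState rhoL uL vL) (mkState rhoR uR vR) UM ->
  SDW_R3 alpha A (mkState rhoL uL vL) (mkState rhoR uR vR) UM' ->
  UM = UM'.
Proof.
  intros Ha HA HL HR H H'.
  assert (Hx : 0 < rho UM) by apply H. assert (Hx' : 0 < rho UM') by apply H'.
  apply SDW_R3_iff in H; [|assumption..]. apply SDW_R3_iff in H'; [|assumption..].
  destruct UM as [x w vM], UM' as [x' w' vM']; cbn [rho u v] in *.
  destruct H as (-> & _ & -> & E), H' as (-> & _ & -> & E').
  destruct (Rtotal_order x x') as [Hl|[->|Hg]]; [|reflexivity|]; exfalso.
  - pose proof (speed_gap_incr alpha (A vL) (A vR) rhoL uL rhoR uR x x'
      Ha (HA vR) HL Hx Hl). lra.
  - pose proof (speed_gap_incr alpha (A vL) (A vR) rhoL uL rhoR uR x' x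
      Ha (HA vR) HL Hx' Hg). lra.
Qed.

(** * Reflection *)

Definition mirror (U : state) : state := mkState (rho U) (- u U) (v U).

Lemma mirror_involutive (U : state) : mirror (mirror U) = U.
Proof. destruct U. unfold mirror; cbn. now rewrite Ropp_involutive. Qed.

(** Reflecting and exchanging the two states keeps [[rho u]] and [SDW_discr]
    and negates [[rho]] and the jump of the momentum flux. *)
Lemma SDW_speed_mirror (alpha : R) (A : R -> R) (Um Up : state) :
  SDW_speed alpha A (mirror Up) (mirror Um) = - SDW_speed alpha A Um Up.
Proof.
  assert (Erho : jump rho (mirror Up) (mirror Um) = - jump rho Um Up)
    by (unfold jump; cbn; ring).
  assert (Emom : jump momentum (mirror Up) (mirror Um) = jump momentum Um Up)
    by (unfold jump, momentum; cbn; ring).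
  assert (Eflux : jump (momentum_flux alpha A) (mirror Up) (mirror Um)
                  = - jump (momentum_flux alpha A) Um Up)
    by (unfold jump, momentum_flux; cbn; ring).
  unfold SDW_speed, SDW_discr. rewrite Erho, Emom, Eflux.
  destruct (Req_dec_T (- jump rho Um Up) 0) as [H|H],
    (Req_dec_T (jump rho Um Up) 0) as [H'|H']; [|lra|lra|].
  - unfold Rdiv. ring.
  - rewrite Rmult_opp_opp. now field.
Qed.

Lemma SDW_speed_defined_mirror (alpha : R) (A : R -> R) (Um Up : state) :
  SDW_speed_defined alpha A Um Up ->
  SDW_speed_defined alpha A (mirror Up) (mirror Um).
Proof.
  unfold SDW_speed_defined, SDW_discr.
  replace (jump rho (mirror Up) (mirror Um)) with (- jump rho Um Up)
    by (unfold jump; cbn; ring).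
  replace (jump momentum (mirror Up) (mirror Um)) with (jump momentum Um Up)
    by (unfold jump, momentum; cbn; ring).
  replace (jump (momentum_flux alpha A) (mirror Up) (mirror Um))
    with (- jump (momentum_flux alpha A) Um Up)
    by (unfold jump, momentum_flux; cbn; ring).
  rewrite Rmult_opp_opp. intros [H1 H2]. split; intros H.
  - apply H1. lra.
  - apply H2. lra.
Qed.

Lemma lambda1_mirror (alpha : R) (A : R -> R) (U : state) :
  lambda1 alpha A (mirror U) = - lambda3 alpha A U.
Proof. unfold lambda1, lambda3; cbn. ring. Qed.

Lemma lambda3_mirror (alpha : R) (A : R -> R) (U : state) :
  lambda3 alpha A (mirror U) = - lambda1 alpha A U.
Proof. unfold lambda1, lambda3; cbn. ring. Qed.

Lemma R1_SDW_mirror (alpha : R) (A : R -> R) (UL UR UM : state) :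
  R1_SDW alpha A UL UR UM <->
  SDW_R3 alpha A (mirror UR) (mirror UL) (mirror UM).
Proof.
  unfold R1_SDW, SDW_R3.
  rewrite SDW_speed_mirror, lambda1_mirror, lambda3_mirror.
  cbn [mirror rho u v].
  split; intros (Hv & Hrho & Hu & Hdef & Hc & Hlt);
    (split; [exact Hv|split; [exact Hrho|split; [lra|split; [|split; lra]]]]).
  - now apply SDW_speed_defined_mirror.
  - apply SDW_speed_defined_mirror in Hdef.
    now rewrite !mirror_involutive in Hdef.
Qed.

(** * Both wave combinations *)

Theorem mainTheorem4 (alpha : R) (A : R -> R)
  (rhoL uL vL rhoR uR vR : R)
  (Halpha : 0 < alpha < 1)
  (HApos : forall x : R, 0 < A x)
  (HAcont : continuity A)
  (HrhoL : 0 < rhoL) (HrhoR : 0 < rhoR) :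
  let UL := mkState rhoL uL vL in
  let UR := mkState rhoR uR vR in
  let AL := A vL in
  let AR := A vR in
  let r := Rpower (AR / AL) (1 / alpha) in
  let gamma := (alpha + 1) / 2 in
  (((exists UM : state, SDW_R3 alpha A UL UR UM) <->
    (r * rhoL < rhoR /\
     uR < uL
          + 2 * sqrt (alpha * AR) / (alpha + 1)
            * (1 / Rpower (r * rhoL) gamma - 1 / Rpower rhoR gamma)
          - sqrt (alpha * AR) / Rpower (r * rhoL) gamma
          - sqrt (alpha * AL / Rpower rhoL (alpha + 1)) /\
     uR > uL
          - sqrt (alpha * AR / Rpower rhoR (alpha + 1))
          - 1 / sqrt rhoL
            * sqrt ((alpha - 1) * AR / Rpower rhoR alpha
                    + AL / Rpower rhoL alpha))) /\
   (forall UM UM' : state,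
      SDW_R3 alpha A UL UR UM -> SDW_R3 alpha A UL UR UM' -> UM = UM'))
  /\
  (((exists UM : state, R1_SDW alpha A UL UR UM) <->
    (rhoR < r * rhoL /\
     uR < uL
          - sqrt (alpha * AL) / Rpower (rhoR / r) gamma
          - sqrt (alpha * AR / Rpower rhoR (alpha + 1))
          + 2 * sqrt (alpha * AL) / (alpha + 1)
            * (1 / Rpower (rhoR / r) gamma - 1 / Rpower rhoL gamma) /\
     uR > uL
          - sqrt (alpha * AL / Rpower rhoL (alpha + 1))
          - 1 / sqrt rhoR
            * sqrt ((alpha - 1) * AL / Rpower rhoL alpha
                    + AR / Rpower rhoR alpha))) /\
   (forall UM UM' : state,
      R1_SDW alpha A UL UR UM -> R1_SDW alpha A UL UR UM' -> UM = UM')).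
Proof.
  intros UL UR AL AR r gamma.
  split; [split|split].
  - now apply SDW_R3_exists_iff.
  - intros UM UM'. now apply SDW_R3_unique.
  - assert (Hr : 0 < r) by apply Rpower_pos.
    assert (HAL : 0 < AL) by apply HApos. assert (HAR : 0 < AR) by apply HApos.
    pose proof (SDW_R3_exists_iff alpha A rhoR (- uR) vR rhoL (- uL) vL
                  Halpha HApos HrhoR HrhoL) as Hex.
    cbv zeta in Hex. fold AL AR gamma in Hex.
    (* The reflected threshold is [(AL / AR)^(1 / alpha) * rhoR = rhoR / r]. *)
    assert (Ea : Rpower (AL / AR) (1 / alpha) * rhoR = rhoR / r).
    { replace (AL / AR) with (/ (AR / AL)) by (field; lra).
      rewrite Rpower_inv_base by now apply Rdiv_lt_0_compat.
      fold r. field. lra. }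
    rewrite Ea in Hex.
    assert (Hthr : rhoR / r < rhoL <-> rhoR < r * rhoL).
    { split; intros H.
      - apply (Rmult_lt_compat_l r) in H; [|exact Hr].
        replace (r * (rhoR / r)) with rhoR in H by (field; lra). exact H.
      - apply (Rmult_lt_reg_l r); [exact Hr|].
        replace (r * (rhoR / r)) with rhoR by (field; lra). exact H. }
    transitivity (exists UM, SDW_R3 alpha A (mkState rhoR (- uR) vR)
                               (mkState rhoL (- uL) vL) UM).
    + split; intros [UM H].
      * exists (mirror UM). now apply R1_SDW_mirror in H.
      * exists (mirror UM). apply R1_SDW_mirror. now rewrite mirror_involutive.
    + rewrite Hex, Hthr. split; intros (H1 & H2 & H3); repeat split; lra.
  - intros UM UM' H H'.
    apply R1_SDW_mirror in H. apply R1_SDW_mirror in H'.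
    rewrite <- (mirror_involutive UM), <- (mirror_involutive UM'). f_equal.
    revert H H'. now apply SDW_R3_unique.
Qed.
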